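(* Let $R$ be a commutative ring, $n,m\ge1$, $f_1,\dots,f_k,g_1,\dots,g_h\in A_R(m)$, and $\alpha\in\mathbb{N}^k$, $\beta\in\mathbb{N}^h$ with $\sum_i\alpha_i\le n$ and $\sum_j\beta_j\le n$. Then $$e_\alpha(f_1,\dots,f_k)\,e_\beta(g_1,\dots,g_h)=\sum_\gamma e_\gamma(f_1,\dots,f_k,g_1,\dots,g_h,f_1g_1,f_1g_2,\dots,f_1g_h,f_2g_1,\dots,f_kg_h),$$ where the sum runs over all tuples $\gamma=(\gamma_{10},\dots,\gamma_{k0},\gamma_{01},\dots,\gamma_{0h},\gamma_{11},\gamma_{12},\dots,\gamma_{kh})$ of nonnegative integers (the entry $\gamma_{i0}$ attached to $f_i$, $\gamma_{0j}$ to $g_j$, and $\gamma_{ij}$ to $f_ig_j$ for $i,j\ge1$) such that $\sum\gamma\le n$ (sum of all entries), $\sum_{j=0}^h\gamma_{ij}=\alpha_i$ for $i=1,\dots,k$, and $\sum_{i=0}^k\gamma_{ij}=\beta_j$ for $j=1,\dots,h$.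
   Context: $A_R(n,m)=R[x_i(j):1\le i\le m,1\le j\le n]$; $A_R(m)=R[y_1,\dots,y_m]$; for $f\in A_R(m)$, $f(j):=f(x_1(j),\dots,x_m(j))$. For $f_1,\dots,f_r\in A_R(m)$ and $\delta\in\mathbb{N}^r$ with $\sum\delta_i\le n$, $e_\delta(f_1,\dots,f_r)\in A_R(n,m)$ is the coefficient of $t_1^{\delta_1}\cdots t_r^{\delta_r}$ in $\prod_{i=1}^n\bigl(1+\sum_{l=1}^r t_lf_l(i)\bigr)$ ($t_l$ commuting indeterminates). *)

(* Defs.v *)
From HB Require Import structures.
From mathcomp Require Import all_boot all_order all_algebra.
From mathcomp Require Export mpoly.

Set Implicit Arguments.
Unset Strict Implicit.
Unset Printing Implicit Defensive.

Import GRing.Theory.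
Local Open Scope ring_scope.

(* A_R(n, m) is {mpoly R[m * n]}: the variable x_i(j) is the one of index
   mxvec_index i j. *)
Definition multisym_var (R : comNzRingType) (n m : nat) (i : 'I_m) (j : 'I_n) :
    {mpoly R[m * n]} :=
  'X_(mxvec_index i j).

(* f(j) = f(x_1(j), ..., x_m(j)) *)
Definition at_point (R : comNzRingType) (n m : nat)
    (f : {mpoly R[m]}) (j : 'I_n) : {mpoly R[m * n]} :=
  f \mPo [tuple multisym_var R i j | i < m].

Definition multisym_gen (R : comNzRingType) (n m r : nat)
    (f : 'rV[{mpoly R[m]}]_r) : {mpoly {mpoly R[m * n]}[r]} :=
  \prod_(j < n) (1 + \sum_(l < r) at_point (f 0 l) j *: 'X_l).

(* e_delta(f_1, ..., f_r), where f_1, ..., f_r are the entries of the row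
   vector f. It is total in delta: no bound on mdeg delta is imposed here. *)
Definition multisym_e (R : comNzRingType) (n m r : nat)
    (delta : 'X_{1..r}) (f : 'rV[{mpoly R[m]}]_r) : {mpoly R[m * n]} :=
  (multisym_gen n f)@_delta.

Arguments multisym_e {R} n {m r} delta f.

(* (f_1, ..., f_k, g_1, ..., g_h, f_1 g_1, f_1 g_2, ..., f_k g_h);
   mxvec lists the entries of a matrix row by row. *)
Definition prod_family (A : comNzRingType) (k h : nat)
    (f : 'rV[A]_k) (g : 'rV[A]_h) : 'rV[A]_(k + h + k * h) :=
  row_mx (row_mx f g) (mxvec (\matrix_(i < k, j < h) (f 0 i * g 0 j))).

(* The exponents gamma_{i0}, gamma_{0j} and gamma_{ij} (i, j >= 1) attached
   to f_i, g_j and f_i g_j in prod_family f g. *)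
Definition expo_f (k h : nat) (gamma : 'X_{1..k + h + k * h}) (i : 'I_k) : nat :=
  gamma (lshift (k * h) (lshift h i)).

Definition expo_g (k h : nat) (gamma : 'X_{1..k + h + k * h}) (j : 'I_h) : nat :=
  gamma (lshift (k * h) (rshift k j)).

Definition expo_fg (k h : nat) (gamma : 'X_{1..k + h + k * h})
    (i : 'I_k) (j : 'I_h) : nat :=
  gamma (rshift (k + h) (mxvec_index i j)).

Definition has_margins (k h : nat) (alpha : 'X_{1..k}) (beta : 'X_{1..h})
    (gamma : 'X_{1..k + h + k * h}) : bool :=
  [forall i, expo_f gamma i + \sum_(j < h) expo_fg gamma i j == alpha i]%N &&
  [forall j, expo_g gamma j + \sum_(i < k) expo_fg gamma i j == beta j]%N.

(* Main.v *)
Require Import Defs.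
From HB Require Import structures.
From mathcomp Require Import all_boot all_order all_algebra.
Import GRing.Theory.
Local Open Scope ring_scope.

(* Substitute in the generating polynomial of prod_family f g the variables
   (t, s, t s) = prod_family t s, where t and s are the first k and the last h
   variables of a polynomial ring in k + h variables. Since
   1 + sum f_i t_i + sum g_j s_j + sum f_i g_j t_i s_j
   = (1 + sum f_i t_i) (1 + sum g_j s_j),
   the result is the product of the generating polynomials of f in t and of g
   in s; the theorem compares the coefficients of t^alpha s^beta. *)

(** [msize] is the degree plus one, and 0 for the zero polynomial; the successors thus make [a] and
    [b] degree bounds, which add up under products. *)
Lemma msizeM_bound {n : nat} {R : nzRingType} (p q : {mpoly R[n]}) (a b : nat) :
  (msize p <= a.+1)%N -> (msize q <= b.+1)%N ->
  (msize (p * q) <= (a + b).+1)%N.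
Proof.
move=> pa qb; rewrite [mmeasure _ (p * q)]/mmeasure.
apply/bigmax_leqP_seq => m /msuppM_le /allpairsP [[m1 m2] /= [m1p m2q ->]] _.
rewrite mdegD ltnS leq_add // -ltnS.
  exact: leq_trans (msize_mdeg_lt m1p) pa.
exact: leq_trans (msize_mdeg_lt m2q) qb.
Qed.

Lemma msize_prod_affine {n : nat} {R : nzRingType} (d : nat)
    (F : 'I_d -> {mpoly R[n]}) :
  (forall j, (msize (F j) <= 2)%N) -> (msize (\prod_j F j) <= d.+1)%N.
Proof.
elim: d F => [|d IHd] F F_le; first by rewrite big_ord0 msize1.
by rewrite big_ord_recl; apply: (msizeM_bound _ _ 1) => //; apply: IHd.
Qed.

(** Each of the [n] factors has degree at most 1 in the ['X_l]. This is why sums over exponents of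
    degree at most [n] miss no coefficient of the generating polynomial. *)
Lemma msize_multisym_gen {R : comNzRingType} {n m r : nat}
    (f : 'rV[{mpoly R[m]}]_r) : (msize (multisym_gen n f) <= n.+1)%N.
Proof.
apply: msize_prod_affine => j.
apply: leq_trans (msizeD_le _ _) _; rewrite geq_max msize1 /=.
apply: leq_trans (msize_sum _ _ _) _; apply/bigmax_leqP => i _.
by apply: leq_trans (msizeZ_le _ _) _; rewrite msizeX mdeg1.
Qed.

Lemma comp_multisym_gen {R : comNzRingType} {n m r s : nat}
    (f : 'rV[{mpoly R[m]}]_r) (v : 'rV[{mpoly {mpoly R[m * n]}[s]}]_r) :
  multisym_gen n f \mPo [tuple v 0 l | l < r] =
  \prod_(j < n) (1 + \sum_(l < r) at_point (f 0 l) j *: v 0 l).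
Proof.
rewrite rmorph_prod; apply: eq_bigr => j _.
rewrite rmorphD rmorph1 rmorph_sum; congr (_ + _); apply: eq_bigr => l _.
by rewrite /= comp_mpolyZ comp_mpolyXU -tnth_nth tnth_mktuple.
Qed.

Lemma comp_multisym_genE {R : comNzRingType} {n m r s : nat}
    (f : 'rV[{mpoly R[m]}]_r) (v : 'rV[{mpoly {mpoly R[m * n]}[s]}]_r) :
  multisym_gen n f \mPo [tuple v 0 l | l < r] =
  \sum_(a : 'X_{1..r < n.+1})
    multisym_e n a f *: \prod_(l < r) v 0 l ^+ a l.
Proof.
rewrite (comp_mpolywE _ (msize_multisym_gen f)); apply: eq_bigr => a _.
by congr (_ *: _); apply: eq_bigr => l _; rewrite tnth_mktuple.
Qed.

Lemma big_prod_family {T : Type} {idx : T}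
    {op : Monoid.com_law idx} {k h : nat} (F : 'I_(k + h + k * h) -> T) :
  \big[op/idx]_l F l =
  op (op (\big[op/idx]_(i < k) F (lshift (k * h) (lshift h i)))
         (\big[op/idx]_(j < h) F (lshift (k * h) (rshift k j))))
     (\big[op/idx]_(i < k) \big[op/idx]_(j < h)
        F (rshift (k + h) (mxvec_index i j))).
Proof.
rewrite !big_split_ord; congr (op _ _).
by rewrite pair_bigA (reindex _ (curry_mxvec_bij k h)); apply: eq_bigr => -[].
Qed.

Section ProdFamily.

Variables (A : comNzRingType) (k h : nat) (f : 'rV[A]_k) (g : 'rV[A]_h).

Lemma prod_family_f i :
  prod_family f g 0 (lshift (k * h) (lshift h i)) = f 0 i.
Proof. by rewrite /prod_family !row_mxEl. Qed.

Lemma prod_family_g j :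
  prod_family f g 0 (lshift (k * h) (rshift k j)) = g 0 j.
Proof. by rewrite /prod_family row_mxEl row_mxEr. Qed.

Lemma prod_family_fg i j :
  prod_family f g 0 (rshift (k + h) (mxvec_index i j)) = f 0 i * g 0 j.
Proof. by rewrite /prod_family row_mxEr mxvecE mxE. Qed.

Definition prod_familyE := (prod_family_f, prod_family_g, prod_family_fg).

End ProdFamily.

Lemma at_pointM {R : comNzRingType} {n m : nat} (p q : {mpoly R[m]}) (j : 'I_n) :
  at_point (p * q) j = at_point p j * at_point q j.
Proof. exact: rmorphM. Qed.

Lemma comp_multisym_gen_prod_family {R : comNzRingType} {n m k h s : nat}
    (f : 'rV[{mpoly R[m]}]_k) (g : 'rV[{mpoly R[m]}]_h)
    (t : 'rV[{mpoly {mpoly R[m * n]}[s]}]_k) (u : 'rV_h) :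
  multisym_gen n (prod_family f g)
    \mPo [tuple prod_family t u 0 l | l < k + h + k * h] =
  (multisym_gen n f \mPo [tuple t 0 i | i < k]) *
  (multisym_gen n g \mPo [tuple u 0 j | j < h]).
Proof.
rewrite !comp_multisym_gen -big_split; apply: eq_bigr => j _ /=.
rewrite big_prod_family /=.
under eq_bigr do rewrite !prod_familyE.
under [X in _ + (_ + X + _)]eq_bigr do rewrite !prod_familyE.
under [X in _ + (_ + _ + X)]eq_bigr => a _.
  under eq_bigr do rewrite !prod_familyE at_pointM -scalerA scalerAr scalerAl.
  over.
(* The double sum folds back into (sum of the f terms) times (sum of the g terms); it remains to
   expand the product of the two affine factors. *)
rewrite /= -big_distrlr /= mulrDl mul1r mulrDr mulr1 !addrA.
by rewrite [1 + _ + \sum_(j < h) _]addrAC.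
Qed.

(** The arguments are plain functions so that row and column sums of exponents can be passed
    directly, as well as multinomials by coercion. *)
Definition mnm_cat {k h : nat} (a : 'I_k -> nat) (b : 'I_h -> nat) :
    'X_{1..k + h} :=
  [multinom match split l with inl i => a i | inr j => b j end | l < k + h].

Lemma eq_mnm_cat {k h : nat} (a a' : 'I_k -> nat) (b b' : 'I_h -> nat) :
  (mnm_cat a b == mnm_cat a' b') =
  [forall i, a i == a' i] && [forall j, b j == b' j].
Proof.
have catl a1 b1 i : @mnm_cat k h a1 b1 (lshift h i) = a1 i.
  by rewrite mnmE (unsplitK (inl i)).
have catr a1 b1 j : @mnm_cat k h a1 b1 (rshift k j) = b1 j.
  by rewrite mnmE (unsplitK (inr j)).
apply/eqP/andP => [ab|[/forallP aa' /forallP bb']].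
  split; apply/forallP => i; apply/eqP.
    by rewrite -(catl a b) ab catl.
  by rewrite -(catr a b) ab catr.
apply/mnmP => l; rewrite !mnmE.
by case: split => i; apply/eqP.
Qed.

Section SplitVariables.

Variables (A : comNzRingType) (k h : nat).

Definition varl : 'rV[{mpoly A[k + h]}]_k := \row_i 'X_(lshift h i).
Definition varr : 'rV[{mpoly A[k + h]}]_h := \row_j 'X_(rshift k j).

Lemma prod_vars (a : 'I_k -> nat) (b : 'I_h -> nat) :
  (\prod_i varl 0 i ^+ a i) * (\prod_j varr 0 j ^+ b j) = 'X_[mnm_cat a b].
Proof.
rewrite mpolyXE_id big_split_ord /=.
congr (_ * _); apply: eq_bigr => i _; rewrite mxE mnmE.
  by rewrite (unsplitK (inl i)).
by rewrite (unsplitK (inr i)).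
Qed.

(** The margin conditions originate here: [varl 0 i] occurs in its own power and in every mixed
    factor of row [i], and [varr 0 j] likewise for column [j]. *)
Lemma prod_prod_family_vars (c : 'X_{1..k + h + k * h}) :
  \prod_l prod_family varl varr 0 l ^+ c l =
  'X_[mnm_cat (fun i => expo_f c i + \sum_(j < h) expo_fg c i j)%N
              (fun j => expo_g c j + \sum_(i < k) expo_fg c i j)%N].
Proof.
rewrite -prod_vars big_prod_family /=.
under eq_bigr do rewrite prod_familyE.
under [X in _ * X * _]eq_bigr do rewrite prod_familyE.
under [X in _ * X = _]eq_bigr => i _.
  under eq_bigr do rewrite prod_familyE exprMn.
  rewrite big_split /= prodrXr; over.
(* Exchanging the products lets the exponents of each [varr 0 j] be added along its column. *)
rewrite big_split /= [X in _ * (_ * X) = _]exchange_big /=.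
under [X in _ * (_ * X) = _]eq_bigr do rewrite prodrXr.
rewrite mulrACA -!big_split /=.
by congr (_ * _); apply: eq_bigr => i _; rewrite -exprD.
Qed.

End SplitVariables.

(* 'X_{1..r < n.+1} is the finite type of the gamma in N^r of sum at most n. *)
Theorem theorem2p1 (R : comNzRingType) (n m k h : nat)
    (n_gt0 : (0 < n)%N) (m_gt0 : (0 < m)%N)
    (f : 'rV[{mpoly R[m]}]_k) (g : 'rV[{mpoly R[m]}]_h)
    (alpha : 'X_{1..k}) (beta : 'X_{1..h})
    (alpha_le : (mdeg alpha <= n)%N) (beta_le : (mdeg beta <= n)%N) :
  multisym_e n alpha f * multisym_e n beta g =
  \sum_(gamma : 'X_{1..(k + h + k * h) < n.+1} | has_margins alpha beta gamma)
     multisym_e n gamma (prod_family f g).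
Proof.
have := comp_multisym_gen_prod_family f g
  (varl {mpoly R[m * n]} k h) (varr {mpoly R[m * n]} k h).
move/(congr1 (mcoeff (mnm_cat alpha beta))).
rewrite !comp_multisym_genE big_distrlr /= !raddf_sum /=.
(* On the side of [prod_family f g], the coefficient of each monomial is the indicator of
   [has_margins], which becomes the condition of the sum. *)
under eq_bigr do rewrite mcoeffZ prod_prod_family_vars mcoeffX eq_mnm_cat
  -/(has_margins alpha beta _) mulr_natr mulrb.
rewrite -big_mkcond => -> /=.
under eq_bigr => a _.
  rewrite raddf_sum /=.
  under eq_bigr do rewrite -scalerAl -scalerAr scalerA mcoeffZ prod_vars
    mcoeffX eq_mnm_cat.
  over.
have eq_ext r (x y : 'X_{1..r}) : [forall i, x i == y i] = (x == y).
  apply/forallP/eqP => [xy|-> //].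
  by apply/mnmP => i; apply/eqP.
(* The degree bounds put [alpha] and [beta] in the finite index types, so that the double sum does
   contain their term; all other terms vanish. *)
have alpha_lt : (mdeg alpha < n.+1)%N by [].
have beta_lt : (mdeg beta < n.+1)%N by [].
rewrite (bigD1 (BMultinom alpha_lt)) //= (bigD1 (BMultinom beta_lt)) //=.
rewrite !eq_ext !eqxx mulr1 !big1 ?addr0 // => [a a_neq|b b_neq].
  rewrite big1 // => b _; rewrite eq_ext.
  by rewrite -[_ == alpha]/(a == BMultinom alpha_lt) (negPf a_neq) mulr0.
rewrite !eq_ext -[_ == beta]/(b == BMultinom beta_lt) (negPf b_neq).
by rewrite andbF mulr0.
Qed.
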